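(* Let $\mathbb{K}$ be a field of characteristic zero, $A$ a finite-dimensional pre-Malcev algebra over $\mathbb{K}$, and $V$ a finite-dimensional $A$-bimodule. Let $(T,N,S)$ be a Kupershmidt-Nijenhuis structure on $A_V$, and let $u,v\in V$ be arbitrary elements. Then: (1) $S$ is a Nijenhuis operator on the algebra $(V,\diamond^{T})$. (2) $NT$ is a Kupershmidt operator on $A_V$. (3) $T$ and $TS$ are compatible Kupershmidt operators on $A_V$. (4) For $k,i\in\mathbb{N}=\{0,1,2,\dots\}$, define $T_k:=TS^k=N^kT$ and, for $x,y\in A$ (in particular for $x,y\in T(V)$), $$x\cdot_{N^{i}}y:=N^{i}(x)\,y+x\,N^{i}(y)-N^{i}(xy).$$ Then $T_k$ is a Kupershmidt operator on $A_V$ and $T_k(u\diamond^{T}_{S^{k+i}}v)=T_{k}(u)\cdot_{N^i}T_{k}(v)$. (5) Any two $T_k,T_j$ are compatible for $k,j\in\mathbb{N}$.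
   Context: A pre-Malcev algebra over $\mathbb{K}$ is a nonassociative algebra $A$ over $\mathbb{K}$ such that for all $x,y,z,t\in A$: $(yz-zy)(xt)+((xy-yx)z-z(xy-yx))t+y((xz-zx)t)-x(y(zt))+z(x(yt))=0$. An $A$-bimodule is a vector space $V$ with linear maps $\ell,r:A\to\mathfrak{gl}(V)$, $x\mapsto\ell_x$, $x\mapsto r_x$, such that for all $x,y,z\in A$: (i) $r_x r_y r_z-r_x r_y\ell_z-r_x\ell_y r_z+r_x\ell_y\ell_z-r_{z(yx)}+\ell_y r_{zx}+\ell_{zy}r_x-\ell_{yz}r_x-\ell_z r_x\ell_y+\ell_z r_x r_y=0$; (ii) $r_{x}r_{y}\ell_{z}-r_{x}r_{y}r_{z}-r_{x}\ell_{y}\ell_{z}+r_{x}\ell_{y}r_{z}-\ell_{z}r_{yx}+\ell_{y}\ell_{z}r_{x}+r_{zx}r_{y}-r_{zx}\ell_{y}-r_{(yz)x}+r_{(zy)x}=0$; (iii) $r_{x}\ell_{yz}-r_{x}\ell_{zy}-r_{x}r_{yz}+r_{x}r_{zy}-\ell_{y}\ell_{z}r_{x}+r_{y(zx)}+r_{yx}\ell_{z}-r_{yx}r_{z}-\ell_{z}r_{x}r_{y}+\ell_{z}r_{x}\ell_{y}=0$; (iv) $\ell_{(xy)z}-\ell_{(yx)z}-\ell_{z(xy)}+\ell_{z(yx)}-\ell_{x}\ell_{y}\ell_{z}+\ell_{z}\ell_{x}\ell_{y}+\ell_{yz}\ell_{x}-\ell_{zy}\ell_{x}-\ell_{y}\ell_{zx}+\ell_{y}\ell_{xz}=0$.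 $A_V$ denotes the action of $A$ on $V$ given by $\ell,r$. A Kupershmidt operator on $A_V$ is a linear map $T:V\to A$ with $T(u)T(v)=T(\ell_{T(u)}(v)+r_{T(v)}(u))$ for all $u,v\in V$. Two Kupershmidt operators $T_1,T_2$ on $A_V$ are compatible if $T_1+T_2$ is a Kupershmidt operator on $A_V$. A Nijenhuis operator on a nonassociative algebra $B$ is a linear map $N:B\to B$ with $N(x)N(y)=N(N(x)y+xN(y)-N(xy))$ for all $x,y\in B$. A Nijenhuis pair on $A_V$ is a pair $(N,S)$ with $N$ a Nijenhuis operator on $A$ and $S:V\to V$ a linear map such that for all $x\in A$: $\ell_{N(x)}S=S\ell_{N(x)}+S\ell_xS-S^2\ell_x$ and $r_{N(x)}S=Sr_{N(x)}+Sr_xS-S^2r_x$. For a linear map $T:V\to A$ and a linear map $S:V\to V$, define multiplications on $V$ by $u\diamond^{T}v:=\ell_{T(u)}(v)+r_{T(v)}(u)$ and $u\diamond^{T}_{S}v:=S(u)\diamond^{T}v+u\diamond^{T}S(v)-S(u\diamond^{T}v)$. (So $u\diamond^T_{S^m}v$ is the latter with $S$ replaced by $S^m$, and $u\diamond^{TS}v$ is the former with $T$ replaced by $TS$.) A Kupershmidt-Nijenhuis structure on $A_V$ is a triple $(T,N,S)$ where $T:V\to A$ is a Kupershmidt operator on $A_V$, $(N,S)$ is a Nijenhuis pair on $A_V$, $TS=NT$, and $u\diamond^{TS}v=u\diamond^{T}_{S}v$ for all $u,v\in V$. *)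

(* Defs.v *)
From HB Require Import structures.
From mathcomp Require Import all_boot all_algebra.

Set Implicit Arguments.
Unset Strict Implicit.
Unset Printing Implicit Defensive.

Import GRing.Theory.
Local Open Scope ring_scope.

(* [\o] on linear maps sits at the same precedence level as [+] and [-]; this
   operator binds tighter, so that sums of compositions read as usual. *)
Notation "f ∘ g" := (comp_lfun f g) (at level 40, left associativity).

(* Composition powers.  ['End(V)] has no canonical ring structure, since [V]
   may be the zero space. *)
Definition lfun_pow (K : fieldType) (V : vectType K) (f : 'End(V)) (n : nat) :
    'End(V) :=
  iter n (comp_lfun f) \1%VF.

Notation "f ^∘ n" := (lfun_pow f n) (at level 30, right associativity).

Lemma lfun_powE (K : fieldType) (V : vectType K) (f : 'End(V)) n x :
  (f ^∘ n) x = iter n f x.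
Proof. by elim: n => [|n IHn] /=; rewrite ?id_lfunE // comp_lfunE IHn. Qed.

(* A nonassociative algebra over [K] is a space with a bilinear product. *)
Section NonassociativeAlgebra.
Variables (K : fieldType) (A : vectType K) (mul : {bilinear A -> A -> A}).
Local Notation "x ⋅ y" := (mul x y) (at level 40, left associativity).

Definition is_pre_malcev : Prop := forall x y z t : A,
  (y ⋅ z - z ⋅ y) ⋅ (x ⋅ t)
  + ((x ⋅ y - y ⋅ x) ⋅ z - z ⋅ (x ⋅ y - y ⋅ x)) ⋅ t
  + y ⋅ ((x ⋅ z - z ⋅ x) ⋅ t)
  - x ⋅ (y ⋅ (z ⋅ t))
  + z ⋅ (x ⋅ (y ⋅ t)) = 0.

Definition deformed_mul (N : 'End(A)) (x y : A) : A :=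
  N x ⋅ y + x ⋅ N y - N (x ⋅ y).

Definition is_nijenhuis (N : 'End(A)) : Prop :=
  forall x y : A, N x ⋅ N y = N (deformed_mul N x y).

Section Bimodule.
Variables (V : vectType K) (l r : 'Hom(A, 'End(V))).

Definition is_bimodule : Prop := forall x y z : A,
  [/\ r x ∘ r y ∘ r z - r x ∘ r y ∘ l z - r x ∘ l y ∘ r z + r x ∘ l y ∘ l z
      - r (z ⋅ (y ⋅ x)) + l y ∘ r (z ⋅ x) + l (z ⋅ y) ∘ r x - l (y ⋅ z) ∘ r x
      - l z ∘ r x ∘ l y + l z ∘ r x ∘ r y = 0,
      r x ∘ r y ∘ l z - r x ∘ r y ∘ r z - r x ∘ l y ∘ l z + r x ∘ l y ∘ r z
      - l z ∘ r (y ⋅ x) + l y ∘ l z ∘ r x + r (z ⋅ x) ∘ r y - r (z ⋅ x) ∘ l y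
      - r ((y ⋅ z) ⋅ x) + r ((z ⋅ y) ⋅ x) = 0,
      r x ∘ l (y ⋅ z) - r x ∘ l (z ⋅ y) - r x ∘ r (y ⋅ z) + r x ∘ r (z ⋅ y)
      - l y ∘ l z ∘ r x + r (y ⋅ (z ⋅ x)) + r (y ⋅ x) ∘ l z - r (y ⋅ x) ∘ r z
      - l z ∘ r x ∘ r y + l z ∘ r x ∘ l y = 0
    & l ((x ⋅ y) ⋅ z) - l ((y ⋅ x) ⋅ z) - l (z ⋅ (x ⋅ y)) + l (z ⋅ (y ⋅ x))
      - l x ∘ l y ∘ l z + l z ∘ l x ∘ l y + l (y ⋅ z) ∘ l x - l (z ⋅ y) ∘ l x
      - l y ∘ l (z ⋅ x) + l y ∘ l (x ⋅ z) = 0].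

End Bimodule.
End NonassociativeAlgebra.

Section Diamond.
Variables (K : fieldType) (A V : vectType K).
Variables (l r : 'Hom(A, 'End(V))) (T : 'Hom(V, A)).

Definition diamond_fun (u v : V) : V := l (T u) v + r (T v) u.

Lemma diamond_bilinear :
  bilinear_for (GRing.Scale.Law.clone _ _ *:%R _)
               (GRing.Scale.Law.clone _ _ *:%R _) diamond_fun.
Proof.
split=> w a u v; rewrite /diamond_fun !linearP /=;
  by rewrite add_lfunE scale_lfunE scalerDr addrACA.
Qed.

HB.instance Definition _ :=
  bilinear_isBilinear.Build K V V V _ _ diamond_fun diamond_bilinear.

Definition diamond : {bilinear V -> V -> V} := diamond_fun.

End Diamond.

Section Kupershmidt.
Variables (K : fieldType) (A : vectType K) (mul : {bilinear A -> A -> A}).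
Variables (V : vectType K) (l r : 'Hom(A, 'End(V))).
Local Notation "x ⋅ y" := (mul x y) (at level 40, left associativity).

Definition is_kupershmidt (T : 'Hom(V, A)) : Prop :=
  forall u v : V, T u ⋅ T v = T (l (T u) v + r (T v) u).

Definition are_compatible (T1 T2 : 'Hom(V, A)) : Prop :=
  [/\ is_kupershmidt T1, is_kupershmidt T2 & is_kupershmidt (T1 + T2)].

Definition is_nijenhuis_pair (N : 'End(A)) (S : 'End(V)) : Prop :=
  is_nijenhuis mul N /\
  forall x : A,
    l (N x) ∘ S = S ∘ l (N x) + S ∘ l x ∘ S - S ^∘ 2 ∘ l x /\
    r (N x) ∘ S = S ∘ r (N x) + S ∘ r x ∘ S - S ^∘ 2 ∘ r x.

Definition is_kupershmidt_nijenhuis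
    (T : 'Hom(V, A)) (N : 'End(A)) (S : 'End(V)) : Prop :=
  [/\ is_kupershmidt T,
      is_nijenhuis_pair N S,
      T ∘ S = N ∘ T
    & forall u v : V,
        diamond l r (T ∘ S) u v = deformed_mul (diamond l r T) S u v].

End Kupershmidt.

(* Main.v *)
Require Import Defs.
From mathcomp Require Import all_boot all_algebra.

Set Implicit Arguments.
Unset Strict Implicit.
Unset Printing Implicit Defensive.

Import GRing.Theory.
Local Open Scope ring_scope.

(** The point is that [(T S, N, S)] is again a Kupershmidt-Nijenhuis structure,
    so that all [T_k := T S^k] carry one.  The condition on the deformed product
    is equivalent to
      [S (u ◇ v) = l (T u) (S v) + r (T v) (S u)];
    this identity, applied to both [T] and [T_i], passes from [S^i] to
    [S^(i + 1)].  Hence deforming [◇^T] by [S^i] gives [◇^{T_i}], and the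
    remaining claims follow from the Kupershmidt identity of the [T_k]. *)

Lemma lfun_powSr (K : fieldType) (V : vectType K) (f : 'End(V)) n :
  f ^∘ n.+1 = f ^∘ n ∘ f.
Proof. by apply/lfunP=> x; rewrite comp_lfunE !lfun_powE iterSr. Qed.

Lemma lfun_powD (K : fieldType) (V : vectType K) (f : 'End(V)) m n :
  f ^∘ (m + n) = f ^∘ m ∘ f ^∘ n.
Proof. by apply/lfunP=> x; rewrite comp_lfunE !lfun_powE iterD. Qed.

Lemma lfun_pow_intertwine (K : fieldType) (A V : vectType K)
    (T : 'Hom(V, A)) (N : 'End(A)) (S : 'End(V)) k :
  T ∘ S = N ∘ T -> T ∘ S ^∘ k = N ^∘ k ∘ T.
Proof.
move=> TS; elim: k => [|k IHk]; first by rewrite comp_lfun1r comp_lfun1l.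
by rewrite lfun_powSr comp_lfunA IHk -comp_lfunA TS comp_lfunA -lfun_powSr.
Qed.

Section Kupershmidt.
Variables (K : fieldType) (A : vectType K) (mul : {bilinear A -> A -> A}).
Variables (V : vectType K) (l r : 'Hom(A, 'End(V))).
Implicit Types (T : 'Hom(V, A)) (N : 'End(A)) (S : 'End(V)).

Lemma diamondE T u v : diamond l r T u v = l (T u) v + r (T v) u.
Proof. by []. Qed.

(** The terms [l (T (S u)) v] and [r (T (S v)) u] occur on both sides of the first equation;
    cancelling them leaves the second. *)
Lemma diamond_deformedE T S u v :
  diamond l r (T ∘ S) u v = deformed_mul (diamond l r T) S u v <->
  S (diamond l r T u v) = l (T u) (S v) + r (T v) (S u).
Proof.
rewrite /deformed_mul !diamondE !comp_lfunE /=.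
set a := l _ v; set b := r _ (S u); set c := l _ (S v); set d := r _ u.
have -> : a + b + (c + d) = a + d + (c + b).
  by rewrite addrACA [b + d]addrC addrACA.
by split=> [/esym/(canRL (subrK _))/addrI|->]; last rewrite addrK.
Qed.

(** Add the pair identity for [l] at [T u], applied to [v], to the one for [r] at [T v], applied to
    [u]; [T ∘ S = N ∘ T] turns [N (T u)] into [T (S u)]. *)
Lemma nijenhuis_pair_diamond T N S :
  is_nijenhuis_pair mul l r N S -> T ∘ S = N ∘ T ->
  is_nijenhuis (diamond l r T) S.
Proof.
move=> [_ pairNS] /lfunP TS u v.
have TSE w : T (S w) = N (T w) by have := TS w; rewrite !comp_lfunE.
have [/lfunP/(_ v) lS _] := pairNS (T u).
have [_ /lfunP/(_ u) rS] := pairNS (T v).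
move: lS rS; rewrite !(add_lfunE, opp_lfunE, comp_lfunE, id_lfunE) => lS rS.
rewrite /deformed_mul !diamondE !TSE lS rS linearB !linearD /=.
rewrite addrACA -opprD.
by congr (_ - _); rewrite [RHS]addrACA [X in _ = _ + X]addrC.
Qed.

Section Structure.
Variables (N : 'End(A)) (S : 'End(V)).
Local Notation structure T := (is_kupershmidt_nijenhuis mul l r T N S).

(** Everything rests on [S (u ◇^{TS} v) = S u ◇^T S v], the Nijenhuis identity of [S]. Applying [T]
    gives the Kupershmidt identity of [T ∘ S]; unfolding the right side gives the criterion
    [diamond_deformedE] for [T ∘ S]. *)
Lemma kupershmidt_nijenhuis_comp T : structure T -> structure (T ∘ S).
Proof.
move=> [kupT pairNS TS deform].
have nijS := nijenhuis_pair_diamond pairNS TS.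
split=> // [u v||u v].
- rewrite -diamondE deform !comp_lfunE -nijS; exact: kupT.
- by rewrite comp_lfunA -TS.
- apply/diamond_deformedE.
  by rewrite deform -nijS diamondE !comp_lfunE.
Qed.

Lemma kupershmidt_nijenhuis_pow T k : structure T -> structure (T ∘ S ^∘ k).
Proof.
move=> knT; elim: k => [|k IHk]; first by rewrite comp_lfun1r.
by rewrite lfun_powSr comp_lfunA; apply: kupershmidt_nijenhuis_comp.
Qed.

Lemma kupershmidt_nijenhuis_diamond_pow T i u v : structure T ->
  (S ^∘ i) (diamond l r T u v) = l (T u) ((S ^∘ i) v) + r (T v) ((S ^∘ i) u).
Proof.
move=> knT.
have step T' u' v' : structure T' ->
    S (diamond l r T' u' v') = l (T' u') (S v') + r (T' v') (S u').
  by case=> _ _ _ deform; apply/diamond_deformedE.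
elim: i => [|i IHi]; first by rewrite !id_lfunE.
rewrite [S ^∘ _]/= !comp_lfunE IHi.
(* Add the case [i = 1] for [T] at [(u, S^i v)] and [(S^i u, v)], and subtract
   the one for [T S^i] at [(u, v)]. *)
have := step _ u v (kupershmidt_nijenhuis_pow i knT).
have := step _ ((S ^∘ i) u) v knT; have := step _ u ((S ^∘ i) v) knT.
rewrite !diamondE !linearD !comp_lfunE /= => e1 e2 e3.
apply: (addIr (S (l (T ((S ^∘ i) u)) v) + S (r (T ((S ^∘ i) v)) u))).
rewrite {2}e3 addrACA [X in _ + X]addrC addrACA e1 e2 addrACA [RHS]addrACA.
by congr (_ + _); apply: addrC.
Qed.

Lemma kupershmidt_nijenhuis_deformed_pow T i u v : structure T ->
  diamond l r (T ∘ S ^∘ i) u v = deformed_mul (diamond l r T) (S ^∘ i) u v.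
Proof.
by move=> knT; apply/diamond_deformedE/kupershmidt_nijenhuis_diamond_pow.
Qed.

Lemma kupershmidt_nijenhuis_compatible_pow T i :
  structure T -> are_compatible mul l r T (T ∘ S ^∘ i).
Proof.
move=> knT; have [kupT _ _ _] := knT.
have [kupTi _ _ _] := kupershmidt_nijenhuis_pow i knT.
split=> // u v.
set T' := T ∘ S ^∘ i in kupTi *.
(* The cross terms are all that remains to match. Moving [S^i] inside the product turns [T' (u ◇ v)]
   into [T (l (T u) (S^i v) + r (T v) (S^i u))], which completes the Kupershmidt identities of [T]
   at [(u, S^i v)] and [(S^i u, v)]. *)
have mixed : mul (T u) (T' v) + mul (T' u) (T v)
    = T (diamond l r T' u v) + T' (diamond l r T u v).
  rewrite !comp_lfunE kupershmidt_nijenhuis_diamond_pow // !kupT diamondE.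
  rewrite -!linearD /=.
  by congr (T _); rewrite !comp_lfunE addrACA [RHS]addrACA [X in X + _]addrC.
have -> : l ((T + T') u) v + r ((T + T') v) u
    = diamond l r T u v + diamond l r T' u v.
  by rewrite !diamondE !add_lfunE !linearD !add_lfunE addrACA.
rewrite !add_lfunE linearDl !linearDr (raddfD T) (raddfD T') /=.
rewrite [mul (T u) (T v)]kupT [mul (T' u) (T' v)]kupTi.
by rewrite -!diamondE addrA -[X in X + _ = _]addrA mixed -!addrA.
Qed.

End Structure.

End Kupershmidt.

Lemma are_compatible_sym (K : fieldType) (A : vectType K)
    (mul : {bilinear A -> A -> A}) (V : vectType K) (l r : 'Hom(A, 'End(V)))
    (T1 T2 : 'Hom(V, A)) :
  are_compatible mul l r T1 T2 -> are_compatible mul l r T2 T1.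
Proof. by case=> kup1 kup2 kup12; split=> //; rewrite addrC. Qed.

Theorem theorem3p6 (K : fieldType) (char0 : [pchar K] =i pred0)
    (A : vectType K) (mul : {bilinear A -> A -> A})
    (A_pre_malcev : is_pre_malcev mul)
    (V : vectType K) (l r : 'Hom(A, 'End(V)))
    (V_bimodule : is_bimodule mul l r)
    (T : 'Hom(V, A)) (N : 'End(A)) (S : 'End(V))
    (TNS : is_kupershmidt_nijenhuis mul l r T N S) :
  [/\ is_nijenhuis (diamond l r T) S,
      is_kupershmidt mul l r (N ∘ T),
      are_compatible mul l r T (T ∘ S),
      forall k i : nat,
        [/\ T ∘ S ^∘ k = N ^∘ k ∘ T,
            is_kupershmidt mul l r (T ∘ S ^∘ k)
          & forall u v : V,
              (T ∘ S ^∘ k) (deformed_mul (diamond l r T) (S ^∘ (k + i)) u v)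
              = deformed_mul mul (N ^∘ i)
                  ((T ∘ S ^∘ k) u) ((T ∘ S ^∘ k) v)]
    & forall k j : nat,
        are_compatible mul l r (T ∘ S ^∘ k) (T ∘ S ^∘ j)].
Proof.
have [_ pairNS TS _] := TNS.
have [kupTS _ _ _] := kupershmidt_nijenhuis_comp TNS.
(* Since [T_k] carries a structure and [T_{k+i} = T_k S^i], compatibility with the base operator
   applies with [T_k] as base. *)
have compat k i :
    are_compatible mul l r (T ∘ S ^∘ k) (T ∘ S ^∘ (k + i)).
  rewrite lfun_powD comp_lfunA.
  apply: (kupershmidt_nijenhuis_compatible_pow i).
  exact: kupershmidt_nijenhuis_pow TNS.
split=> [||| k i | k j].
- exact: nijenhuis_pair_diamond pairNS TS.
- by rewrite -TS.
- by have := compat 0 1; rewrite /= !comp_lfun1r.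
- have knTk := kupershmidt_nijenhuis_pow k TNS; have [kupTk _ TkS _] := knTk.
  split=> // [|u v]; first exact: lfun_pow_intertwine.
  (* Deforming [◇^T] by [S^(k+i)] gives the product of [T_{k+i}], which is also that of [T_k]
     deformed by [S^i]. Then [T_k] is multiplicative and carries [S^i] to [N^i]. *)
  rewrite -(kupershmidt_nijenhuis_deformed_pow (k + i) u v TNS).
  rewrite lfun_powD comp_lfunA.
  rewrite (kupershmidt_nijenhuis_deformed_pow i u v knTk) /deformed_mul.
  have /lfunP TkSi := lfun_pow_intertwine i TkS.
  set Tk := T ∘ S ^∘ k in kupTk TkSi *.
  have NTk w : (N ^∘ i) (Tk w) = Tk ((S ^∘ i) w).
    by have := TkSi w; rewrite !comp_lfunE.
  by rewrite linearB linearD /= !NTk !kupTk NTk.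
- case/orP: (leq_total k j) => /subnKC <-; first exact: compat.
  exact/are_compatible_sym/compat.
Qed.
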